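(* Let $G$ be a connected graph of order $n\geq 5$. If $\gamma_{t[1,2]}(G)<+\infty$, then $\gamma_{t[1,2]}(G)\leq \frac{4n}{5}$, with equality if and only if $G=H\circ 2P_2$ for some connected graph $H$ of order at least two.
   Context: All graphs are finite, simple and undirected; $N(v)$ denotes the neighborhood of $v$. A set $S\subseteq V(G)$ is a total $[1,2]$-set of $G$ if $1\leq |N(v)\cap S|\leq 2$ for every vertex $v\in V(G)$. $\gamma_{t[1,2]}(G)$ is the minimum cardinality of a total $[1,2]$-set of $G$, with $\gamma_{t[1,2]}(G)=+\infty$ if no such set exists. For a graph $H$ with vertex set $\{u_1,\dots,u_k\}$, the double corona $H\circ 2P_2$ is the graph with vertex set $V(H)\cup\{x_i,x_i',y_i,y_i' : 1\leq i\leq k\}$ (all new vertices distinct) and edge set $E(H)\cup\{u_ix_i,\,x_ix_i',\,u_iy_i,\,y_iy_i' : 1\leq i\leq k\}$. *)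

(* Defs.v *)
From mathcomp Require Import all_boot all_order all_algebra.
From mathcomp Require Import constructive_ereal.

Set Implicit Arguments.
Unset Strict Implicit.
Unset Printing Implicit Defensive.

Import Order.TTheory GRing.Theory Num.Theory.

Record sgraph := SGraph {
  svertex :> finType;
  sedge : rel svertex;
  sedge_sym : symmetric sedge;
  sedge_irr : irreflexive sedge
}.

Definition neigh (G : sgraph) (v : G) : {set G} := [set w | sedge v w].

Definition sconnected (G : sgraph) : Prop :=
  forall x y : G, connect (@sedge G) x y.

Definition sisomorphic (G H : sgraph) : Prop :=
  exists2 f : G -> H, bijective f &
    forall x y : G, sedge (f x) (f y) = sedge x y.

Definition total12_set (G : sgraph) (S : {set G}) : bool :=
  [forall v : G, 1 <= #|neigh v :&: S| <= 2].

(* The minimum over an empty family is the default value +oo. *)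
Definition gamma_t12 (G : sgraph) : \bar rat :=
  \big[Order.min/+oo%E]_(S : {set G} | total12_set S) (#|S|%:R)%:E.

(* [inl u] is the vertex u of H; [inr (u, b, c)] belongs to the path with
   index b attached to u, [c = false] being its vertex adjacent to u and
   [c = true] its end vertex: x = (u, false, false), x' = (u, false, true),
   y = (u, true, false), y' = (u, true, true). *)
Definition dcorona_vertex (H : sgraph) : finType := (H + H * bool * bool)%type.

Definition dcorona_edge (H : sgraph) : rel (dcorona_vertex H) := fun p q =>
  match p, q with
  | inl u, inl v => sedge u v
  | inl u, inr (v, _, c) | inr (v, _, c), inl u => (u == v) && ~~ c
  | inr (u, b, c), inr (v, b', c') => [&& u == v, b == b' & c != c']
  end.

Lemma dcorona_sym (H : sgraph) : symmetric (@dcorona_edge H).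
Proof.
move=> [u|[[u b] c]] [v|[[v b'] c']] //=; first exact: sedge_sym.
by rewrite (eq_sym u) (eq_sym b) (eq_sym c).
Qed.

Lemma dcorona_irr (H : sgraph) : irreflexive (@dcorona_edge H).
Proof. by move=> [u|[[u b] c]] /=; rewrite ?sedge_irr // !eqxx. Qed.

Definition dcorona (H : sgraph) : sgraph :=
  SGraph (@dcorona_sym H) (@dcorona_irr H).

(* Main.v *)
(* Let S be a total [1,2]-set of least cardinality. Deleting a vertex v of S must
   destroy the property, so v is the only S-neighbour of some vertex w. If v has
   no neighbour outside S, then w lies in S, and by connectedness w has a
   neighbour outside S. As v is determined by w, at least half of S belongs to
   the boundary B, the set of vertices of S with an outside neighbour. Each
   outside vertex has at most two neighbours in S, so |S| <= 2|B| <= 4(n - |S|).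
   In case of equality every outside vertex has exactly two neighbours in S, so
   the vertices w above lie in S and match S perfectly. Each pair has exactly one
   member in B, with one outside neighbour: this is a double corona over V \ S,
   which has more than one vertex because P_5 = K_1 o 2P_2 only needs three.
   Conversely, in a double corona over a connected graph of order at least two,
   the support vertices x_i, y_i are forced into S, hence no u_j is in S, and so
   all x_i', y_i' are in S. *)
Require Import Defs.
From mathcomp Require Import all_boot all_order all_algebra.
From mathcomp Require Import constructive_ereal.

Import Order.TTheory GRing.Theory Num.Theory.
Local Open Scope ring_scope.
Local Open Scope ereal_scope.

(** * Minimal total [1,2]-sets and private neighbours *)

Lemma in_neigh {G : sgraph} (v w : G) : (w \in neigh v) = sedge v w.
Proof. by rewrite inE. Qed.

Lemma closed_setT {G : sgraph} {A : {set G}} {x : G} :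
  sconnected G -> x \in A -> (forall y, y \in A -> neigh y \subset A) ->
  A = [set: G].
Proof.
move=> Gconn xA clA; apply/setP => y; rewrite inE.
have cl : closed (@sedge G) (mem A).
  apply: intro_closed; first exact/sym_connect_sym/sedge_sym.
  by move=> u v uv /clA /subsetP; apply; rewrite in_neigh.
by have := closed_connect cl (Gconn x y); rewrite xA.
Qed.

(** Testing single deletions amounts to inclusion-minimality: any set between two nested total
    [1,2]-sets is again one. *)
Definition minimal12 {G : sgraph} (S : {set G}) : Prop :=
  total12_set S /\ forall v, v \in S -> ~~ total12_set (S :\ v).

(** Deleting [v] cannot break the upper bound 2, so some [w] loses its only neighbour in [S]. *)
Lemma private_neigh {G : sgraph} {S : {set G}} {v : G} :
  minimal12 S -> v \in S -> exists w, neigh w :&: S = [set v].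
Proof.
move=> [/forallP tS mS] /mS; rewrite negb_forall => /existsP[w].
have /andP[w1 w2] := tS w.
rewrite setIDA (leq_trans (subset_leq_card (subsetDl _ _)) w2) andbT.
rewrite -leqNgt leqn0 cards_eq0 setD_eq0 subset1.
by case/orP=> /eqP e; [exists w | move: w1; rewrite e cards0].
Qed.

(** * The boundary and the count of edges leaving [S] *)

Definition boundary {G : sgraph} (S : {set G}) : {set G} :=
  [set v in S | ~~ (neigh v \subset S)].

Lemma mem_boundary {G : sgraph} {S : {set G}} (v : G) :
  (v \in boundary S) = (v \in S) && (0 < #|neigh v :\: S|)%N.
Proof. by rewrite inE lt0n cards_eq0 setD_eq0. Qed.

(* A vertex v of S without neighbours outside S has its private neighbour w in
   S; if w had no outside neighbour either, the private neighbour of w would be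
   v, and {v, w} would be a component of G. *)
Lemma private_boundary {G : sgraph} {S : {set G}} {v w : G} :
  sconnected G -> (2 < #|G|)%N -> minimal12 S -> v \in S :\: boundary S ->
  neigh w :&: S = [set v] -> w \in boundary S.
Proof.
move=> Gconn G3 mS; rewrite inE [v \in boundary S]inE => /andP[].
move=> /[swap] vS; rewrite vS /= negbK => nvS ew.
have wv : sedge w v by have := set11 v; rewrite -ew !inE => /andP[].
have wS : w \in S by apply: (subsetP nvS); rewrite in_neigh sedge_sym.
rewrite inE wS /=; apply/negP => nwS.
have [x ex] := private_neigh mS wS.
have xw : sedge x w by have := set11 w; rewrite -ex !inE => /andP[].
have : x \in neigh w :&: S.
  by rewrite inE in_neigh sedge_sym xw (subsetP nwS) // in_neigh sedge_sym.
rewrite ew inE => /eqP xE; rewrite {x xw}xE in ex.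
have e2 : [set v; w] = [set: G].
  apply: closed_setT Gconn (set21 v w) _ => y /set2P[]->.
    by rewrite -(setIidPl nvS) ex sub1set set22.
  by rewrite -(setIidPl nwS) ew sub1set set21.
by move: G3; rewrite -cardsT -e2 cards2; case: (v != w).
Qed.

(** A private neighbour determines its vertex, so choosing one for each vertex off the boundary
    injects these vertices into the boundary. *)
Lemma card_setD_boundary {G : sgraph} {S : {set G}} :
  sconnected G -> (2 < #|G|)%N -> minimal12 S ->
  (#|S :\: boundary S| <= #|boundary S|)%N.
Proof.
move=> Gconn G3 mS.
have /fin_all_exists[f fP] (v : G) :
    exists w, v \in S -> neigh w :&: S = [set v].
  case: (boolP (v \in S)) => [/(private_neigh mS)[w]|_]; first by exists w.
  by exists v.
rewrite -(card_in_imset (f := f)).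
  apply/subset_leq_card/subsetP => _ /imsetP[v vD ->].
  by apply: (private_boundary Gconn G3 mS vD); apply: fP; case/setDP: vD.
move=> u v /setDP[/fP eu _] /setDP[/fP ev _] e.
by apply: set1_inj; rewrite -eu -ev e.
Qed.

(** Both sides count the edges between [S] and its complement. *)
Lemma sum_boundary {G : sgraph} (S : {set G}) :
  (\sum_(v in boundary S) #|neigh v :\: S| =
   \sum_(w in ~: S) #|neigh w :&: S|)%N.
Proof.
transitivity (\sum_(v in S) #|neigh v :\: S|)%N.
  rewrite [RHS](bigID (fun v => v \in boundary S)) /= [X in (_ + X)%N]big1 ?addn0.
    by apply: eq_bigl => v; rewrite andb_idl // mem_boundary => /andP[].
  by move=> v; rewrite mem_boundary => /andP[->] /=; rewrite lt0n negbK => /eqP.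
under eq_bigr do rewrite -sum1_card.
under [RHS]eq_bigr do rewrite -sum1_card.
rewrite (exchange_big_dep (mem (~: S))) /=; last first.
  by move=> u v; rewrite !inE => _ /andP[].
apply: eq_bigr => w wS; apply: eq_bigl => v.
by move: wS; rewrite !inE => ->; rewrite sedge_sym andbC.
Qed.

(** The [leqif] form keeps the equality condition for the extremal case. *)
Lemma boundary_leqif {G : sgraph} (S : {set G}) :
  (#|boundary S| <= \sum_(v in boundary S) #|neigh v :\: S|
     ?= iff [forall v in boundary S, #|neigh v :\: S| == 1])%N.
Proof.
rewrite -sum1_card.
have := @leqif_sum _ (fun v => v \in boundary S) (fun v => #|neigh v :\: S| == 1%N)
  (fun=> 1%N) (fun v => #|neigh v :\: S|).
apply => v; rewrite mem_boundary => /andP[_ h].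
by split=> //; rewrite eq_sym.
Qed.

Lemma outside_leqif {G : sgraph} {S : {set G}} : total12_set S ->
  (\sum_(w in ~: S) #|neigh w :&: S| <= #|~: S| * 2
     ?= iff [forall w in ~: S, #|neigh w :&: S| == 2])%N.
Proof.
move=> /forallP tS; rewrite -sum_nat_const.
have := @leqif_sum _ (mem (~: S)) (fun w => #|neigh w :&: S| == 2%N)
  (fun w => #|neigh w :&: S|) (fun=> 2%N).
by apply=> w _; split=> //; have /andP[] := tS w.
Qed.

Lemma minimal12_card {G : sgraph} {S : {set G}} :
  sconnected G -> (2 < #|G|)%N -> minimal12 S -> (#|S| <= 4 * #|~: S|)%N.
Proof.
move=> Gconn G3 mS.
have h1 := card_setD_boundary Gconn G3 mS.
have h2 := (boundary_leqif S).1; have h3 := (outside_leqif mS.1).1.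
have bS : boundary S \subset S by apply/subsetP => v; rewrite inE => /andP[].
rewrite sum_boundary in h2; have {h2 h3}h2 := leq_trans h2 h3.
rewrite -(cardsID (boundary S) S) (setIidPr bS).
by apply: leq_trans (leq_add h2 (leq_trans h1 h2)) _; rewrite -mulnDr mulnC.
Qed.

(** * The equality case: a perfect matching inside [S] *)

Lemma extremal_boundary {G : sgraph} {S : {set G}} :
  sconnected G -> (2 < #|G|)%N -> minimal12 S -> #|S| = (4 * #|~: S|)%N ->
  [/\ #|boundary S| = #|S :\: boundary S|,
      forall v, v \in boundary S -> #|neigh v :\: S| = 1%N
    & forall w, w \notin S -> #|neigh w :&: S| = 2%N].
Proof.
move=> Gconn G3 mS cS.
have h1 := card_setD_boundary Gconn G3 mS.
have [h2 e2] := boundary_leqif S; have [h3 e3] := outside_leqif mS.1.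
have bS : boundary S \subset S by apply/subsetP => v; rewrite inE => /andP[].
rewrite sum_boundary in h2 e2.
rewrite -(cardsID (boundary S) S) (setIidPr bS) in cS.
(* [#|S|] is at most twice the size of the boundary; halve [4 * #|~: S| <= 2 * #|boundary S|]. *)
have b2 : (#|~: S| * 2 <= #|boundary S|)%N.
  rewrite -(leq_pmul2r (m := 2)) // -mulnA mulnC -cS muln2 -addnn.
  by rewrite leq_add2l.
have eb : #|boundary S| = (#|~: S| * 2)%N.
  by apply/eqP; rewrite eqn_leq b2 (leq_trans h2 h3).
split.
- by apply: (@addnI #|boundary S|); rewrite cS eb -mulnDr mulnC.
- move: e2; rewrite eqn_leq h2 (leq_trans h3 b2) => /esym/forall_inP e v /e.
  by move/eqP.
- move: e3; rewrite eqn_leq h3 (leq_trans b2 h2) => /esym/forall_inP e w wS.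
  by apply/eqP/e; rewrite inE.
Qed.

(** Take for [m v] a vertex whose only [S]-neighbour is [v]; it lies in [S] because outside vertices
    have two [S]-neighbours. *)
Lemma extremal_matching {G : sgraph} {S : {set G}} :
  sconnected G -> (2 < #|G|)%N -> minimal12 S -> #|S| = (4 * #|~: S|)%N ->
  exists m : G -> G, forall v, v \in S ->
    [/\ m v \in S, m (m v) = v, neigh v :&: S = [set m v]
      & (m v \in boundary S) = (v \notin boundary S)].
Proof.
move=> Gconn G3 mS cS.
have [eA _ e2] := extremal_boundary Gconn G3 mS cS.
have /fin_all_exists[m mP] (v : G) :
    exists w, v \in S -> neigh w :&: S = [set v].
  case: (boolP (v \in S)) => [/(private_neigh mS)[w]|_]; first by exists w.
  by exists v.
have mS' v : v \in S -> m v \in S.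
  by move=> /mP e; apply: contraT => /e2; rewrite e cards1.
(* [m (m v)] is an [S]-neighbour of [m v], and [v] is the only one. *)
have mK v : v \in S -> m (m v) = v.
  move=> vS; apply/set1P; rewrite -(mP _ vS) inE (mS' _ (mS' _ vS)) andbT.
  have := set11 (m v); rewrite -(mP _ (mS' _ vS)) !inE => /andP[+ _].
  by rewrite sedge_sym.
have mD v : v \in S :\: boundary S -> m v \in boundary S.
  move=> vD; apply: (private_boundary Gconn G3 mS vD).
  by apply: mP; case/setDP: vD.
(* An injection between sets of equal size is onto, so partners of boundary vertices lie off the
   boundary. *)
have mDA : m @: (S :\: boundary S) = boundary S.
  apply/eqP; rewrite eqEcard; apply/andP; split.
    by apply/subsetP => _ /imsetP[v /mD ? ->].
  rewrite eA card_in_imset // => u v /setDP[uS _] /setDP[vS _] e.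
  by rewrite -(mK u) // e mK.
exists m => v vS; split; [exact: mS'|exact: mK| |].
  by rewrite -{1}(mK v vS) mP // mS'.
case: (boolP (v \in boundary S)) => [|vA]; last by apply: mD; rewrite inE vA.
rewrite -{1}mDA => /imsetP[u uD vE]; have [uS uA] := setDP uD.
by rewrite vE mK // (negPf uA).
Qed.

(** * Isomorphism, connectedness and order of double coronas *)

Lemma sisomorphic_sym {G K : sgraph} : sisomorphic G K -> sisomorphic K G.
Proof.
move=> [f [g fK gK] fe]; exists g; first by exists f.
by move=> x y; rewrite -fe !gK.
Qed.

(** Edges may go to paths because projecting a corona onto its base collapses the pendant edges. *)
Lemma connect_homo {T U : finType} {e : rel T} {e' : rel U} {f : T -> U} :
  (forall x y, e x y -> connect e' (f x) (f y)) ->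
  forall x y, connect e x y -> connect e' (f x) (f y).
Proof.
move=> fe x y /connectP[s + ->]; elim: s x => //= z s IHs x /andP[/fe xz /IHs].
exact: connect_trans.
Qed.

Lemma sconnected_iso {G K : sgraph} :
  sisomorphic G K -> sconnected G -> sconnected K.
Proof.
move=> [f [g fK gK] fe] Gconn x y; rewrite -(gK x) -(gK y).
apply: connect_homo (Gconn _ _) => u v uv.
by apply: connect1; rewrite fe.
Qed.

Lemma sconnected_dcorona {H : sgraph} : sconnected (dcorona H) -> sconnected H.
Proof.
move=> Hconn u v.
pose r (p : dcorona H) : H :=
  match p with inl u => u | inr (u, _, _) => u end.
apply: (@connect_homo _ _ _ _ r _ (inl u) (inl v)) => //.
move=> [x|[[x b] c]] [y|[[y b'] c']] //=; first exact: connect1.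
- by case/andP=> /eqP-> _.
- by case/andP=> /eqP-> _.
- by case/and3P=> /eqP->.
Qed.

Lemma card_dcorona (H : sgraph) : #|dcorona H| = (5 * #|H|)%N.
Proof.
rewrite [LHS]card_sum !card_prod card_bool -mulnA [(_ * (2 * 2))%N]mulnC.
by rewrite -mulSn.
Qed.

(** * An extremal graph is a double corona over the vertices outside [S] *)

Definition induced_edge {G : sgraph} (P : pred G) : rel {x | P x} :=
  relpre val (@sedge G).

Lemma induced_sym {G : sgraph} (P : pred G) : symmetric (induced_edge P).
Proof. by move=> x y; apply: sedge_sym. Qed.

Lemma induced_irr {G : sgraph} (P : pred G) : irreflexive (induced_edge P).
Proof. by move=> x; apply: sedge_irr. Qed.

Definition induced {G : sgraph} (P : pred G) : sgraph :=
  SGraph (induced_sym P) (induced_irr P).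

Lemma extremal_dcorona {G : sgraph} {S : {set G}} :
  sconnected G -> (2 < #|G|)%N -> minimal12 S -> #|S| = (4 * #|~: S|)%N ->
  sisomorphic G (dcorona (induced (fun w => w \notin S))).
Proof.
move=> Gconn G3 mS cS; set H := induced _.
have [_ e1 e2] := extremal_boundary Gconn G3 mS cS.
have [m mP] := extremal_matching Gconn G3 mS cS.
have eS u v : u \in S -> v \in S -> sedge u v = (v == m u).
  by move=> /mP[_ _ e _] vS; rewrite -in_set1 -e !inE vS andbT.
have /fin_all_exists[a aP] (v : G) :
    exists w, v \in boundary S -> neigh v :\: S = [set w].
  case: (boolP (v \in boundary S)) => [/e1/eqP/cards1P[w]|_]; first by exists w.
  by exists v.
have eA w v : w \notin S -> v \in S -> sedge w v = (v \in boundary S) && (a v == w).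
  move=> wS vS; case: (boolP (v \in boundary S)) => [/aP e|vA] /=.
    by rewrite eq_sym -in_set1 -e !inE wS sedge_sym.
  apply: contraNF vA; rewrite inE vS sedge_sym => vw.
  by apply/subsetPn; exists w; rewrite ?in_neigh.
(* [p w] lists the two [S]-neighbours of [w], which become the inner vertices of its pendant
   paths. *)
have /fin_all_exists[p pP] (w : G) : exists p : bool -> G,
    w \notin S -> injective p /\ forall b, p b \in neigh w :&: S.
  case: (boolP (w \in S)) => [_|/e2/eqP/cards2P[x [y [xy e]]]].
    by exists (fun=> w).
  exists (fun b => if b then x else y) => _; rewrite e.
  split; last by case; rewrite !inE eqxx ?orbT.
  by case=> [] [] // /eqP; rewrite ?(negPf xy) // eq_sym (negPf xy).
have pS (w : H) b : p (val w) b \in S.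
  by have [_ /(_ b)] := pP _ (valP w); rewrite inE => /andP[].
have pA (w : H) b : p (val w) b \in boundary S /\ a (p (val w) b) = val w.
  have [_ /(_ b)] := pP _ (valP w); rewrite in_setI in_neigh => /andP[+ _].
  by rewrite eA ?pS ?(valP w) // => /andP[-> /eqP].
have p_inj (w w' : H) b b' : (p (val w) b == p (val w') b') = (w == w') && (b == b').
  apply/eqP/andP=> [e|[/eqP-> /eqP->]//].
  have ww' : w = w' by apply/val_inj; rewrite -(pA w b).2 e (pA w' b').2.
  by rewrite -ww' in e *; rewrite eqxx ((pP _ (valP w)).1 _ _ e).
pose s (x : H * bool * bool) : G :=
  let: (w, b, c) := x in if c then m (p (val w) b) else p (val w) b.
have sS x : s x \in S.
  by case: x => [[w b] []] /=; [case: (mP _ (pS w b))|exact: pS].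
have sA w b c : (s (w, b, c) \in boundary S) = ~~ c.
  case: c => /=; last exact: (pA w b).1.
  by have [_ _ _ ->] := mP _ (pS w b); rewrite (pA w b).1.
have sm w b c : m (s (w, b, c)) = s (w, b, ~~ c).
  by case: c => //=; case: (mP _ (pS w b)).
(* Boundary membership reveals [c]; then [m] can be undone and [p_inj] applies. *)
have s_eq w b c w' b' c' :
    (s (w, b, c) == s (w', b', c')) = [&& w == w', b == b' & c == c'].
  have [->|cc'] := eqVneq c c'.
    rewrite andbT; case: c' => /=; rewrite -p_inj //.
    apply/eqP/eqP => [e|->//].
    by have [_ <- _ _] := mP _ (pS w b); rewrite e; case: (mP _ (pS w' b')).
  rewrite !andbF; apply: contraNF cc' => /eqP e.
  by rewrite -(inj_eq negb_inj) -(sA w b) -(sA w' b') e.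
pose g (q : dcorona H) : G := match q with inl w => val w | inr x => s x end.
apply: sisomorphic_sym; exists g.
  apply: inj_card_bij.
    move=> [w|[[w b] c]] [w'|[[w' b'] c']] //= e.
    - by congr inl; apply: val_inj.
    - by case/negP: (valP w); rewrite [val w]e; apply: (sS (w', b', c')).
    - by case/negP: (valP w'); rewrite -[val w']e; apply: (sS (w, b, c)).
    - by move/eqP: e; rewrite (s_eq w b c w' b' c') => /and3P[/eqP-> /eqP-> /eqP->].
  rewrite card_dcorona -(cardsC S) cS card_sig -mulSnr.
  by rewrite leq_mul2l /=; apply/subset_leq_card/subsetP => w; rewrite !inE.
have gA (w w' : H) b c : sedge (val w) (s (w', b, c)) = (w == w') && ~~ c.
  rewrite eA ?sS ?sA //; last exact: valP w.
  by case: c; rewrite ?andbF //= (pA w' b).2 andbT eq_sym.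
move=> [w|[[w b] c]] [w'|[[w' b'] c']] //.
- exact: gA.
- by rewrite sedge_sym [LHS]gA /= eq_sym.
- rewrite [LHS]eS ?sS // sm s_eq /= (eq_sym w') (eq_sym b').
  by case: c c' => [] [].
Qed.

(** * Total [1,2]-sets of double coronas *)

Lemma dcorona_inr_eq {H : sgraph} (u v : H) (b b' c c' : bool) :
  (inr (u, b, c) == inr (v, b', c') :> dcorona H) = [&& u == v, b == b' & c == c'].
Proof. by rewrite andbA. Qed.

(** The corona is a path on five vertices, and its three middle vertices suffice. *)
Lemma dcorona_small {H : sgraph} :
  #|H| = 1%N -> exists2 T : {set dcorona H}, total12_set T & #|T| = 3%N.
Proof.
move/eqP/fintype1P => [u uP].
pose x b : dcorona H := inr (u, b, false).
have x_neq : x false != x true by apply/eqP.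
exists (inl u |: [set x false; x true]); last by rewrite cardsU1 cards2 !inE x_neq.
apply/forallP => -[w|[[w b] c]]; rewrite (uP w).
  suff -> : neigh (inl u : dcorona H) :&: (inl u |: [set x false; x true]) =
            [set x false; x true] by rewrite cards2 x_neq.
  apply/setP => -[v|[[v b] c]]; rewrite (uP v) !inE /=.
    by rewrite sedge_irr.
  by rewrite !dcorona_inr_eq eqxx; case: b c => [] [].
suff -> : neigh (inr (u, b, c) : dcorona H) :&: (inl u |: [set x false; x true]) =
          [set if c then x b else inl u] by rewrite cards1.
apply/setP => -[v|[[v b'] c']]; rewrite (uP v) !inE /= !eqxx /=.
  by case: c => //=; rewrite [RHS]eqxx.
rewrite !dcorona_inr_eq !eqxx; case: c; rewrite ?dcorona_inr_eq ?eqxx.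
  by case: b b' c' => [] [] [].
by case: b b' c' => [] [] [].
Qed.

Lemma dcorona_total12_card {H : sgraph} {T : {set dcorona H}} :
  sconnected H -> (1 < #|H|)%N -> total12_set T -> (4 * #|H| <= #|T|)%N.
Proof.
move=> Hconn H2 /forallP tT.
(* This is the only neighbour of an end vertex. *)
have xT u b : (inr (u, b, false) : dcorona H) \in T.
  have /andP[/card_gt0P[q]] := tT (inr (u, b, true)); rewrite !inE => + _.
  case: q => [v|[[v b'] c']] /=; first by rewrite andbF.
  by case/andP => /and3P[/eqP<- /eqP<-]; case: c'.
(* Otherwise a neighbour [v] of [u] in [H] has three neighbours in [T]: [u] and its own two inner
   path vertices. *)
have uT u : (inl u : dcorona H) \notin T.
  have [v uv] : exists v, sedge u v.
    apply/existsP; apply: contraTT H2; rewrite negb_exists => /forallP nu.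
    rewrite -leqNgt -cardsT -(closed_setT Hconn (set11 u)) ?cards1 // => y.
    by move=> /set1P->; apply/subsetP => v; rewrite in_neigh (negPf (nu v)).
  apply/negP => uT; have /andP[_] := tT (inl v); apply/negP; rewrite -ltnNge.
  pose B : {set dcorona H} :=
    inl u |: [set inr (v, false, false); inr (v, true, false)].
  have <- : #|B| = 3%N.
    by rewrite cardsU1 cards2 !inE dcorona_inr_eq /= andbF.
  apply/subset_leq_card/subsetP => q.
  by rewrite !inE => /or3P[] /eqP-> /=;
    rewrite ?uT ?xT ?eqxx ?andbT // sedge_sym.
(* With [u] excluded, only the end vertex can dominate the inner one. *)
have yT u b : (inr (u, b, true) : dcorona H) \in T.
  have /andP[/card_gt0P[q]] := tT (inr (u, b, false)); rewrite !inE => + _.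
  case: q => [v|[[v b'] c']] /=; first by rewrite (negPf (uT v)) andbF.
  by case/andP => /and3P[/eqP<- /eqP<-]; case: c'.
pose f (x : H * bool * bool) : dcorona H := inr x.
have -> : (4 * #|H|)%N = #|f @: setT|.
  rewrite card_imset => [|x y []//].
  by rewrite cardsT !card_prod card_bool -mulnA mulnC.
apply/subset_leq_card/subsetP => _ /imsetP[[[u b] []] _ ->]; first exact: yT.
exact: xT.
Qed.

Lemma total12_preim {G K : sgraph} {T : {set K}} :
  sisomorphic G K -> total12_set T ->
  exists2 S : {set G}, total12_set S & #|S| = #|T|.
Proof.
move=> [f f_bij fe] /forallP tT.
have cardf (A : {set K}) : #|f @^-1: A| = #|A|.
  exact/on_card_preimset/onW_bij.
exists (f @^-1: T) => //; apply/forallP => v.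
suff -> : neigh v :&: f @^-1: T = f @^-1: (neigh (f v) :&: T) by rewrite cardf.
by apply/setP => w; rewrite !inE fe.
Qed.

(** * The parameter as an attained minimum, and the bound *)

Lemma gamma_t12_le {G : sgraph} {S : {set G}} :
  total12_set S -> gamma_t12 G <= (#|S|%:R)%:E.
Proof. by move=> tS; exact: bigmin_le_cond. Qed.

Lemma gamma_t12_attained {G : sgraph} :
  gamma_t12 G < +oo ->
  exists2 S : {set G}, total12_set S & gamma_t12 G = (#|S|%:R)%:E.
Proof.
move=> Gfin.
have [S tS|no] := pickP (@total12_set G); last first.
  (* Over an empty family the minimum is its default [+oo], against finiteness. *)
  by move: Gfin; rewrite /gamma_t12 big_pred0 // ltxx.
rewrite /gamma_t12 (bigmin_eq_arg _ _ _ _ tS) => [|T _]; last exact: leey.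
by case: arg_minP => // T tT _; exists T.
Qed.

Lemma minimum_minimal12 {G : sgraph} {S : {set G}} :
  total12_set S -> (forall T : {set G}, total12_set T -> (#|S| <= #|T|)%N) ->
  minimal12 S.
Proof.
move=> tS Smin; split=> // v vS; apply/negP => /Smin.
by rewrite (cardsD1 v S) vS ltnn.
Qed.

Theorem theorem2p3 (G : sgraph) (Gconn : sconnected G) (Gorder : (5 <= #|G|)%N)
    (Gfin : gamma_t12 G < +oo) :
  gamma_t12 G <= ((4 * #|G|)%:R / 5)%:E /\
  (gamma_t12 G = ((4 * #|G|)%:R / 5)%:E <->
   exists H : sgraph,
     [/\ sconnected H, (2 <= #|H|)%N & sisomorphic G (dcorona H)]).
Proof.
have G3 : (2 < #|G|)%N by apply: leq_trans Gorder.
have [S tS gS] := gamma_t12_attained Gfin.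
have Smin (T : {set G}) : total12_set T -> (#|S| <= #|T|)%N.
  by move=> /gamma_t12_le; rewrite gS lee_fin ler_nat.
have mS := minimum_minimal12 tS Smin.
have le5 : (#|S| * 5 <= 4 * #|G|)%N.
  rewrite -(cardsC S) mulnDr mulnSr mulnC leq_add2l.
  exact: minimal12_card Gconn G3 mS.
rewrite gS lee_fin ler_pdivlMr // -natrM ler_nat; split=> //.
have -> : ((#|S|%:R)%:E = ((4 * #|G|)%:R / 5)%:E :> \bar rat) <->
    (#|S| * 5 = 4 * #|G|)%N.
  split=> [e|e]; last by rewrite -e natrM mulfK.
  by apply/eqP; rewrite -(eqr_nat rat) natrM (EFin_inj e) divfK.
split=> [eS|[H [Hconn H2 GH]]].
  have cS : #|S| = (4 * #|~: S|)%N.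
    by apply: (@addnI (4 * #|S|)%N); rewrite -mulnDr cardsC -eS mulnSr mulnC.
  have GH := extremal_dcorona Gconn G3 mS cS.
  set H := induced _ in GH; exists H; split=> //.
    exact/sconnected_dcorona/(sconnected_iso GH).
  have cG : #|G| = (5 * #|H|)%N.
    by have [f /bij_eq_card -> _] := GH; rewrite card_dcorona.
  (* [5 <= #|G|] leaves only order one to exclude: there [#|S|] is 4, but a set of size 3 exists. *)
  rewrite ltn_neqAle -(leq_pmul2l (m := 5)) // -cG Gorder andbT.
  apply/negP => /eqP/esym H1.
  have [T tT cT] := dcorona_small H1; have [U tU cU] := total12_preim GH tT.
  by have := Smin U tU; rewrite cU cT -(leq_pmul2r (m := 5)) // eS cG H1.
have cG : #|G| = (5 * #|H|)%N.
  by have [f /bij_eq_card -> _] := GH; rewrite card_dcorona.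
have [T tT cT] := total12_preim (sisomorphic_sym GH) tS.
apply/eqP; rewrite eqn_leq le5 cG mulnCA mulnC leq_mul2r /= -cT.
exact: dcorona_total12_card.
Qed.
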